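(* Let $\mathbb X_i$, $i\in I$, be pairwise disjoint connected $L_b$-structures. Then $\bigcup_{i\in I}\mathbb X_i$ is reversible iff $\bigcup_{i\in J}\mathbb X_i$ is reversible for every non-empty $J\subseteq I$. Consequently, if $\bigcup_{i\in I}\mathbb X_i$ is reversible, then every $\mathbb X_i$, $i\in I$, is reversible.
   Context: An $L_b$-structure is a pair $\langle X,\rho\rangle$ with $\rho\subseteq X^2$. A homomorphism $f:\langle X,\rho\rangle\to\langle Y,\sigma\rangle$ is a map with $\langle x,y\rangle\in\rho\Rightarrow\langle f(x),f(y)\rangle\in\sigma$; a condensation is a bijective homomorphism. A structure is reversible iff every condensation from it to itself is an automorphism. The components of $\langle X,\rho\rangle$ are the classes of the smallest equivalence relation on $X$ containing $\rho$; the structure is connected iff it has exactly one component. ''Pairwise disjoint'' means the domains are pairwise disjoint, and $\bigcup_{i\in J}\langle X_i,\rho_i\rangle=\langle\bigcup_{i\in J}X_i,\bigcup_{i\in J}\rho_i\rangle$. *)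

(* Defs.v *)
From mathcomp Require Import all_boot.
From mathcomp Require Import boolp classical_sets functions.

Set Implicit Arguments.
Unset Strict Implicit.
Unset Printing Implicit Defensive.

Local Open Scope classical_set_scope.

(* The domain is a subset of an ambient type, so that disjointness and union of
   domains are meaningful. *)
Record Lb_structure (T : Type) := LbStructure {
  Lb_dom : set T;
  Lb_rel : set (T * T);
  Lb_rel_sub : Lb_rel `<=` Lb_dom `*` Lb_dom }.

(* Maps between structures are total functions on the ambient types, of which
   only the restriction to the domain is constrained. In [reversible] this loses
   nothing: every self-map of a domain extends by the identity. *)
Definition homomorphism (T U : Type) (X : Lb_structure T) (Y : Lb_structure U)
    (f : T -> U) : Prop :=
  set_fun (Lb_dom X) (Lb_dom Y) f /\
  forall x y, Lb_rel X (x, y) -> Lb_rel Y (f x, f y).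

Definition condensation (T U : Type) (X : Lb_structure T) (Y : Lb_structure U)
    (f : T -> U) : Prop :=
  homomorphism X Y f /\ set_bij (Lb_dom X) (Lb_dom Y) f.

Definition isomorphism (T U : Type) (X : Lb_structure T) (Y : Lb_structure U)
    (f : T -> U) : Prop :=
  set_bij (Lb_dom X) (Lb_dom Y) f /\
  forall x y, Lb_dom X x -> Lb_dom X y ->
    (Lb_rel X (x, y) <-> Lb_rel Y (f x, f y)).

Definition automorphism (T : Type) (X : Lb_structure T) (f : T -> T) : Prop :=
  isomorphism X X f.

Definition reversible (T : Type) (X : Lb_structure T) : Prop :=
  forall f : T -> T, condensation X X f -> automorphism X f.

Definition equivalence_on (T : Type) (D : set T) (E : set (T * T)) : Prop :=
  [/\ E `<=` D `*` D,
      forall x, D x -> E (x, x),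
      forall x y, E (x, y) -> E (y, x) &
      forall x y z, E (x, y) -> E (y, z) -> E (x, z)].

Definition Lb_equiv (T : Type) (X : Lb_structure T) : set (T * T) :=
  smallest (equivalence_on (Lb_dom X)) (Lb_rel X).

Definition components (T : Type) (X : Lb_structure T) : set (set T) :=
  [set [set y | Lb_equiv X (x, y)] | x in Lb_dom X].

Definition Lb_connected (T : Type) (X : Lb_structure T) : Prop :=
  exists C : set T, components X = [set C].

Definition pairwise_disjoint (T I : Type) (X : I -> Lb_structure T) : Prop :=
  trivIset setT (fun i => Lb_dom (X i)).

Lemma Lb_union_sub (T I : Type) (J : set I) (X : I -> Lb_structure T) :
  \bigcup_(i in J) Lb_rel (X i) `<=`
  (\bigcup_(i in J) Lb_dom (X i)) `*` (\bigcup_(i in J) Lb_dom (X i)).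
Proof. by move=> p [i Ji /Lb_rel_sub[p1 p2]]; split; exists i. Qed.

Definition Lb_union (T I : Type) (J : set I) (X : I -> Lb_structure T) :
    Lb_structure T :=
  LbStructure (@Lb_union_sub T I J X).

(* Main.v *)
Require Import Defs.
From mathcomp Require Import all_boot.
From mathcomp Require Import boolp classical_sets functions.

Set Implicit Arguments.
Unset Strict Implicit.
Unset Printing Implicit Defensive.

Local Open Scope classical_set_scope.

(** A condensation of a subunion, extended by the identity on the remaining
    structures, is a condensation of the whole union; by disjointness, the
    resulting automorphism restricts to an automorphism of the subunion. *)

(** Once both equalities are eliminated, the two inclusion proofs have the same type, and proof
    irrelevance identifies them. *)
Lemma Lb_structure_ext (T : Type) (X Y : Lb_structure T) :
  Lb_dom X = Lb_dom Y -> Lb_rel X = Lb_rel Y -> X = Y.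
Proof.
case: X Y => [D r sr] [E s ss] /= DE rs; case: E / DE ss => ss.
by case: s / rs ss => ss; congr LbStructure; exact: Prop_irrelevance.
Qed.

Lemma Lb_union_set1 (T I : Type) (i : I) (X : I -> Lb_structure T) :
  Lb_union [set i] X = X i.
Proof. by apply: Lb_structure_ext; rewrite /= bigcup_set1. Qed.

Lemma pairwise_disjoint_eq (T I : Type) (X : I -> Lb_structure T) i j x :
  pairwise_disjoint X -> Lb_dom (X i) x -> Lb_dom (X j) x -> i = j.
Proof. by move=> dX Xix Xjx; apply: dX => //; exists x. Qed.

(** A related pair lies inside a single [X i]; by disjointness, one endpoint in the [J]-part already
    forces [i] into [J]. *)
Lemma Lb_union_rel_restrict (T I : Type) (X : I -> Lb_structure T)
    (J K : set I) x y :
  pairwise_disjoint X -> Lb_rel (Lb_union K X) (x, y) ->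
  Lb_dom (Lb_union J X) x \/ Lb_dom (Lb_union J X) y ->
  Lb_rel (Lb_union J X) (x, y).
Proof.
move=> dX [i _ ri]; have /= [Xix Xiy] := Lb_rel_sub ri.
case=> -[j Jj Xj]; exists i => //.
- by rewrite (pairwise_disjoint_eq dX Xix Xj).
- by rewrite (pairwise_disjoint_eq dX Xiy Xj).
Qed.

Lemma reversible_subunion (T I : Type) (X : I -> Lb_structure T)
    (J K : set I) :
  pairwise_disjoint X -> J `<=` K ->
  reversible (Lb_union K X) -> reversible (Lb_union J X).
Proof.
move=> dX JK revK f [[fJ fhom] fbij]; have [_ finj fsurj] := fbij.
pose DJ := Lb_dom (Lb_union J X); pose DK := Lb_dom (Lb_union K X).
have DJK : DJ `<=` DK by move=> x [i /JK Ki Xix]; exists i.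
pose g x := if pselect (DJ x) then f x else x.
have gJ x : DJ x -> g x = f x by rewrite /g; case: pselect.
have gN x : ~ DJ x -> g x = x by rewrite /g; case: pselect.
(* Points outside [DJ] are fixed, so none enters [DJ]; this keeps the two halves of [g] from
   colliding in the injectivity proof. *)
have gDJ x : DJ (g x) -> DJ x.
  by case: (pselect (DJ x)) => // Jx; rewrite gN.
have gK : set_fun DK DK g.
  move=> x Kx; case: (pselect (DJ x)) => Jx; last by rewrite gN.
  by rewrite gJ //; exact/DJK/fJ.
have ghom x y : Lb_rel (Lb_union K X) (x, y) ->
    Lb_rel (Lb_union K X) (g x, g y).
  (* No related pair straddles [DJ] and its complement: either both points move by [f], or both are
     fixed. *)
  move=> rxy; case: (pselect (DJ x \/ DJ y)) => [Jxy|/not_orP[Jx Jy]].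
    have rJ := Lb_union_rel_restrict dX rxy Jxy.
    have /= [Jx Jy] := Lb_rel_sub rJ.
    by rewrite !gJ //; have [i /JK Ki ri] := fhom _ _ rJ; exists i.
  by rewrite !gN.
have gbij : set_bij DK DK g.
  split=> //.
  - move=> x y _ _ gxy; case: (pselect (DJ x)) => Jx.
      have Jy : DJ y by apply: gDJ; rewrite -gxy gJ //; exact: fJ.
      by apply: finj; rewrite ?inE // -!gJ.
    have Jy : ~ DJ y.
      by move=> Jy; apply/Jx/gDJ; rewrite gxy gJ //; exact: fJ.
    by rewrite -(gN _ Jx) gxy gN.
  - move=> y Ky; case: (pselect (DJ y)) => [/fsurj[x Jx <-]|Jy].
      by exists x; [exact: DJK | exact: gJ].
    by exists y => //; exact: gN.
have [_ giso] := revK g (conj (conj gK ghom) gbij).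
split=> // x y Jx Jy; split; first exact: fhom.
(* The related images are viewed in the [K]-union, pulled back there along [g], and the resulting
   pair is brought back to the [J]-union. *)
move=> [i /JK Ki ri]; apply: (@Lb_union_rel_restrict _ _ _ J K) => //; last by left.
by apply/(giso _ _ (DJK _ Jx) (DJK _ Jy)); rewrite !gJ //; exists i.
Qed.

Theorem theorem2p1 (T I : Type) (X : I -> Lb_structure T)
    (hdisj : pairwise_disjoint X)
    (hconn : forall i : I, Lb_connected (X i)) :
  (reversible (Lb_union [set: I] X) <->
     forall J : set I, J !=set0 -> reversible (Lb_union J X)) /\
  (reversible (Lb_union [set: I] X) -> forall i : I, reversible (X i)).
Proof.
have sub J : reversible (Lb_union [set: I] X) -> reversible (Lb_union J X).
  exact: reversible_subunion.
split; last by move=> revX i; rewrite -(Lb_union_set1 i X); exact: sub.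
split=> [revX J _|revJ]; first exact: sub.
(* For non-empty [I], take [J] to be all of [I]. For empty [I] there is no such [J], but the union
   has empty domain and is trivially reversible. *)
case: (pselect ([set: I] !=set0)) => [/revJ //|I0 f [_ fbij]].
by split=> // x y [i]; case: I0; exists i.
Qed.
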